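(* Let $K \ge 0$ and $\gamma>0$ be real, let $t,x\in\mathbb{C}$ with $|t| \le 1$ and $|x| \le e^{-\gamma}$, and let $N\ge 0$ be an integer. (a) If $N \ge \sqrt{ \dfrac{\pi^2}{3\gamma^2} + \dfrac{2K}{\gamma} }$, then $\Delta_N \le e^{-K}$. (b) If $N \ge \sqrt{ \dfrac{2\pi^2}{3\gamma^2} + \dfrac{2K}{\gamma} }$, then $\delta_N \le e^{-K}$.
   Context: For complex $t$ and $x$ with $|x|<1$, define $R(t,x) = \prod_{n=1}^\infty (1-tx^n)$ and, for integers $n\ge 0$, $$a_n = \frac{(-t)^n x^{n(n+1)/2}}{(1-x)(1-x^2)\cdots(1-x^n)}$$ (with $a_0=1$). By Euler's identity, $R(t,x) = \sum_{n=0}^\infty a_n$. The absolute truncation error is $\Delta_N = \left|\sum_{n=N}^\infty a_n\right|$ and the relative truncation error is $\delta_N = \left|\sum_{n=N}^\infty a_n\right| / |R(t,x)|$. *)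

(* Defs.v *)
From Stdlib Require Export Reals.
From Coquelicot Require Export Coquelicot.

Open Scope R_scope.

(* f n * f (n+1) * ... * f m, equal to 1 when m < n; the multiplicative
   counterpart of Coquelicot's [sum_n_m]. *)
Definition Cprod_n_m (f : nat -> C) (n m : nat) : C :=
  Iter.iter_nat Cmult (RtoC 1) f n m.

(* Coquelicot's [Series] and [Lim_seq] are real-valued only.  As in the
   library's definition of [RInt], the complex versions below pick "the" value
   with [iota]; they are meaningful when the series or sequence converges. *)
Definition CSeries (a : nat -> C) : C :=
  @iota C_CompleteNormedModule (fun l : C => is_series a l).

Definition CLim_seq (u : nat -> C) : C :=
  @iota C_CompleteNormedModule (fun l : C => filterlim u eventually (locally l)).

Definition Rtx (t x : C) : C :=
  CLim_seq (Cprod_n_m (fun n => (1 - t * x ^ n)%C) 1).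

(* [n * (n + 1) / 2] is a division in [nat], exact because n(n+1) is even. *)
Definition euler_coef (t x : C) (n : nat) : C :=
  ((- t) ^ n * x ^ (n * (n + 1) / 2) / Cprod_n_m (fun k => (1 - x ^ k)%C) 1 n)%C.

Definition abs_trunc_error (t x : C) (N : nat) : R :=
  Cmod (CSeries (fun k => euler_coef t x (N + k))).

Definition rel_trunc_error (t x : C) (N : nat) : R :=
  abs_trunc_error t x N / Cmod (Rtx t x).

Lemma CSeries_unique (a : nat -> C) (l : C) : is_series a l -> CSeries a = l.
Proof. exact (iota_filterlim_locally (V := C_CompleteNormedModule) (sum_n a) l). Qed.

Lemma CLim_seq_unique (u : nat -> C) (l : C) :
  filterlim u eventually (locally l) -> CLim_seq u = l.
Proof. exact (iota_filterlim_locally (V := C_CompleteNormedModule) u l). Qed.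

(* Main.v *)
(* Put q = exp (- gamma), s = sqrt q and (q)_n = (1 - q) ... (1 - q ^ n).
   Expanding the logarithms and using sum_j 1 / j ^ 2 <= PI ^ 2 / 6 gives
   (q)_n >= exp (- PI ^ 2 / (6 gamma)) =: c for all n, which bounds |R(t,x)| from
   below.  Moreover |a_n| <= q ^ (n (n + 1) / 2) / (q)_n, and for n >= 1 the two
   spare factors in 1 / (q)_n = (1 - q ^ (n + 1)) (1 - q ^ (n + 2)) / (q)_(n + 2)
   suffice to make this at most (s ^ (n ^ 2) - s ^ ((n + 1) ^ 2)) / c.  The tail
   then telescopes to exp (- gamma N ^ 2 / 2) / c; the case N = 0 is excluded by
   the hypotheses on N. *)

Require Import Defs.
From Stdlib Require Import Reals Lra Lia.
From Coquelicot Require Import Coquelicot.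

(** * Partial sums of 1 / k^2, through sums of inverse squared sines *)

Lemma sum_n_m_fold (g : nat -> R) (m : nat) :
  sum_n_m g 1 (2 * m + 1) =
  sum_n_m (fun k => g k + g (2 * m + 2 - k)%nat) 1 m + g (m + 1)%nat.
Proof.
  revert g; induction m as [|m IH]; intros g.
  - rewrite (sum_n_m_zero (G := R_AbelianMonoid) _ 1 0) by lia.
    rewrite sum_n_n.
    now change (g 1%nat = 0 + g 1%nat); rewrite Rplus_0_l.
  - replace (2 * S m + 1)%nat with (S (S (2 * m + 1))) by lia.
    rewrite sum_n_Sm, sum_Sn_m by lia.
    rewrite (sum_Sn_m (G := R_AbelianMonoid) _ 1 (S m)) by lia.
    rewrite <- !sum_n_m_S, (IH (fun k => g (S k))).
    rewrite (sum_n_m_ext_loc (G := R_AbelianMonoid)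
      (fun n => g (S n) + g (2 * S m + 2 - S n)%nat)
      (fun k => g (S k) + g (S (2 * m + 2 - k)))).
    + replace (2 * S m + 2 - 1)%nat with (S (S (2 * m + 1))) by lia.
      replace (S m + 1)%nat with (S (m + 1)) by lia.
      unfold plus; simpl; ring.
    + intros k Hk; f_equal; f_equal; lia.
Qed.

(** The angles lie strictly between 0 and PI / 2, where the sine is positive and below its argument,
    and the reflection x -> PI / 2 - x permutes them. *)
Definition sum_inv_sin2 (M : nat) : R :=
  sum_n_m (fun k => / sin (INR k * (PI / (2 * INR M))) ^ 2) 1 (M - 1).

Lemma inv_sin2_double (x : R) : 0 < x < PI / 2 ->
  / sin x ^ 2 + / sin (PI / 2 - x) ^ 2 = 4 * / sin (2 * x) ^ 2.
Proof.
  intros Hx.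
  rewrite sin_shift, sin_2a.
  assert (0 < sin x) by (apply sin_gt_0; lra).
  assert (0 < cos x) by (apply cos_gt_0; lra).
  assert (H1 := sin2_cos2 x); unfold Rsqr in H1.
  replace (/ sin x ^ 2 + / cos x ^ 2)
    with ((sin x * sin x + cos x * cos x) / (sin x ^ 2 * cos x ^ 2)) by (field; lra).
  rewrite H1; field; lra.
Qed.

(** Folding the sum pairs each angle x with PI / 2 - x. By [inv_sin2_double] a pair contributes 4
    times the term at 2 x, which is a term of the sum for [M]; the unpaired middle angle PI / 4
    contributes 2. *)
Lemma sum_inv_sin2_double (M : nat) : (1 <= M)%nat ->
  sum_inv_sin2 (2 * M) = 4 * sum_inv_sin2 M + 2.
Proof.
  intros HM; unfold sum_inv_sin2.
  replace (2 * M - 1)%nat with (2 * (M - 1) + 1)%nat by lia.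
  assert (HM' : 1 <= INR M) by (apply (le_INR 1); lia).
  assert (HPI := PI_RGT_0).
  rewrite sum_n_m_fold; f_equal.
  - rewrite <- (sum_n_m_mult_l (K := R_Ring)).
    apply (sum_n_m_ext_loc (G := R_AbelianMonoid)); intros k Hk.
    rewrite minus_INR by lia.
    assert (1 <= INR k <= INR M - 1).
    { split; [apply (le_INR 1); lia|].
      replace (INR M - 1) with (INR (M - 1)) by (rewrite minus_INR by lia; reflexivity).
      apply le_INR; lia. }
    replace (2 * (M - 1) + 2)%nat with (2 * M)%nat by lia.
    rewrite mult_INR; change (INR 2) with 2.
    replace ((2 * INR M - INR k) * (PI / (2 * (2 * INR M))))
      with (PI / 2 - INR k * (PI / (2 * (2 * INR M)))) by (field; lra).
    rewrite inv_sin2_double.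
    + change (mult 4) with (Rmult 4); do 4 f_equal; field; lra.
    + assert (0 < PI / (2 * (2 * INR M))) by (apply Rdiv_lt_0_compat; lra).
      split; [nra|].
      apply Rlt_le_trans with (2 * INR M * (PI / (2 * (2 * INR M)))); [nra|].
      right; field; lra.
  - replace (M - 1 + 1)%nat with M by lia.
    rewrite mult_INR; change (INR 2) with 2.
    replace (INR M * (PI / (2 * (2 * INR M)))) with (PI / 4) by (field; lra).
    rewrite sin_PI4.
    assert (H2 : sqrt 2 * sqrt 2 = 2) by (apply sqrt_sqrt; lra).
    assert (0 < sqrt 2) by (apply sqrt_lt_R0; lra).
    replace ((1 / sqrt 2) ^ 2) with (/ (sqrt 2 * sqrt 2)) by (field; lra).
    rewrite H2; field.
Qed.

Lemma sum_inv_sin2_pow2 (n : nat) : sum_inv_sin2 (2 ^ n) = 2 * (4 ^ n - 1) / 3.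
Proof.
  induction n as [|n IH].
  - unfold sum_inv_sin2; rewrite sum_n_m_zero by (simpl; lia).
    change (0 = 2 * (4 ^ 0 - 1) / 3); simpl; field.
  - change (2 ^ S n)%nat with (2 * 2 ^ n)%nat.
    rewrite sum_inv_sin2_double.
    + rewrite IH; simpl; field.
    + apply Nat.neq_0_lt_0, Nat.pow_nonzero; lia.
Qed.

Lemma sum_n_m_nonneg_le (u : nat -> R) (n m p : nat) :
  (forall k, 0 <= u k) -> (m <= p)%nat -> sum_n_m u n m <= sum_n_m u n p.
Proof.
  intros Hu Hmp; induction Hmp as [|p Hmp IH]; [lra|].
  destruct (Nat.le_gt_cases n (S p)) as [H|H].
  - rewrite sum_n_Sm by lia.
    specialize (Hu (S p)); unfold plus; simpl; lra.
  - rewrite !sum_n_m_zero in * by lia; lra.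
Qed.

Lemma sum_n_m_le_loc (a b : nat -> R) (n m : nat) :
  (forall k, (n <= k <= m)%nat -> a k <= b k) -> sum_n_m a n m <= sum_n_m b n m.
Proof.
  intros H.
  (* The pointwise minimum equals [a] on the range and lies below [b] at every index, as
     [sum_n_m_le] requires. *)
  rewrite (sum_n_m_ext_loc (G := R_AbelianMonoid) a (fun k => Rmin (a k) (b k))).
  - apply sum_n_m_le; intros k; apply Rmin_r.
  - intros k Hk; symmetry; apply Rmin_left; auto.
Qed.

(* [sin x < x] turns the exact value of [sum_inv_sin2 M] into this upper bound
   on the partial sums. *)
Lemma sum_inv_sq_le (n : nat) : sum_n_m (fun k => / INR k ^ 2) 1 n <= PI ^ 2 / 6.
Proof.
  assert (Hpos : forall k, 0 <= / INR k ^ 2).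
  (* At k = 0 the term is [/ 0], which is 0 by convention. *)
  { intros [|k]; [simpl; rewrite Rmult_0_l, Rinv_0; lra|].
    left; apply Rinv_0_lt_compat, pow_lt, lt_0_INR; lia. }
  assert (Hn : (n < 2 ^ n)%nat) by (apply Nat.pow_gt_lin_r; lia).
  (* The terms are nonnegative, so the sum may be lengthened until the closed form at a power of two
     applies. *)
  apply Rle_trans with (sum_n_m (fun k => / INR k ^ 2) 1 (2 ^ n - 1)).
  { apply sum_n_m_nonneg_le; [exact Hpos|lia]. }
  set (M := (2 ^ n)%nat) in *.
  assert (HPI := PI_RGT_0).
  assert (HM' : 1 <= INR M) by (apply (le_INR 1); lia).
  assert (HMn : INR M ^ 2 = 4 ^ n).
  { unfold M; rewrite pow_INR, <- pow_mult, Nat.mul_comm, pow_mult.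
    f_equal; simpl; ring. }
  set (c := PI / (2 * INR M)).
  assert (Hc : 0 < c) by (apply Rdiv_lt_0_compat; lra).
  apply Rle_trans with (c ^ 2 * sum_inv_sin2 M).
  - unfold sum_inv_sin2; fold c.
    rewrite <- (sum_n_m_mult_l (K := R_Ring)).
    apply sum_n_m_le_loc; intros k Hk; change mult with Rmult.
    assert (1 <= INR k) by (apply (le_INR 1); lia).
    assert (INR k < INR M) by (apply lt_INR; lia).
    assert (Hkc : 0 < INR k * c) by nra.
    assert (HMc : INR M * c = PI / 2) by (unfold c; field; lra).
    assert (0 < sin (INR k * c)) by (apply sin_gt_0; nra).
    assert (sin (INR k * c) < INR k * c) by (apply sin_lt_x; lra).
    replace (/ INR k ^ 2) with (c ^ 2 * / (INR k * c) ^ 2) by (field; lra).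
    apply Rmult_le_compat_l; [nra|].
    apply Rinv_le_contravar; nra.
  - replace (sum_inv_sin2 M) with (2 * (INR M ^ 2 - 1) / 3)
      by (rewrite HMn; symmetry; apply sum_inv_sin2_pow2).
    (* Once the -1 is dropped, M cancels and exactly PI^2 / 6 remains. *)
    apply Rle_trans with (c ^ 2 * (2 * INR M ^ 2 / 3)).
    + apply Rmult_le_compat_l; [apply pow2_ge_0|]; lra.
    + right; unfold c; field; lra.
Qed.

(** * Lower bound for the finite products (1 - q) ... (1 - q^m) *)

(** Taylor polynomial of - ln (1 - y) at 0, of degree [J + 1]. *)
Definition log_trunc (J : nat) (y : R) : R :=
  sum_n (fun i => y ^ S i / INR (S i)) J.

Lemma is_derive_log_trunc (J : nat) (y : R) :
  is_derive (log_trunc J) y (sum_n (fun i => y ^ i) J).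
Proof.
  apply (is_derive_sum_n (fun i y => y ^ S i / INR (S i))).
  intros i _.
  assert (INR (S i) <> 0) by (apply not_0_INR; lia).
  auto_derive; [exact I|].
  change (match i with 0%nat => 1 | S _ => INR i + 1 end) with (INR (S i)).
  simpl Nat.pred; field; assumption.
Qed.

Lemma sum_pow_geom (J : nat) (y : R) : y <> 1 ->
  sum_n (fun i => y ^ i) J = (1 - y ^ S J) / (1 - y).
Proof.
  intros Hy; rewrite sum_n_Reals; apply tech3, Hy.
Qed.

(** The difference of the logarithm and its Taylor polynomial vanishes at 0 and has derivative
    z^(J+1) / (1 - z), which increases on [0, y]. The mean value theorem bounds it by y times the
    derivative at y, and y < 1. *)
Lemma neg_ln_le_log_trunc (J : nat) (y : R) : 0 <= y < 1 ->
  - ln (1 - y) <= log_trunc J y + y ^ S J / (1 - y).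
Proof.
  intros Hy.
  set (f := fun z => - ln (1 - z) - log_trunc J z).
  set (df := fun z => z ^ S J / (1 - z)).
  assert (Hd : forall z, 0 <= z <= y -> is_derive f z (df z)).
  { intros z Hz; unfold f, df.
    replace (z ^ S J / (1 - z)) with (minus (/ (1 - z)) (sum_n (fun i => z ^ i) J)).
    - apply (is_derive_minus (fun z => - ln (1 - z)));
        [|apply is_derive_log_trunc].
      auto_derive; [lra|field; lra].
    - rewrite sum_pow_geom by lra; unfold minus, plus, opp; simpl; field; lra. }
  destruct (MVT_gen f 0 y df) as [c [Hc Hfc]].
  - intros z Hz; rewrite Rmin_left, Rmax_right in Hz by lra; apply Hd; lra.
  - intros z Hz; rewrite Rmin_left, Rmax_right in Hz by lra.
    apply continuity_pt_filterlim, (ex_derive_continuous f).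
    eexists; apply Hd; lra.
  - rewrite Rmin_left, Rmax_right in Hc by lra.
    assert (H0 : f 0 = 0).
    { unfold f, log_trunc.
      rewrite Rminus_0_r, ln_1, (sum_n_ext _ (fun _ => 0)).
      - rewrite sum_n_const; ring.
      - intros i; simpl; unfold Rdiv; ring. }
    assert (0 <= c ^ S J <= y ^ S J)
      by (split; [apply pow_le|apply pow_incr]; lra).
    assert (Hdf : df c <= y ^ S J / (1 - y)).
    { unfold df; apply Rmult_le_compat; try lra.
      - left; apply Rinv_0_lt_compat; lra.
      - apply Rinv_le_contravar; lra. }
    assert (0 <= df c).
    { unfold df; apply Rmult_le_pos; [lra|].
      left; apply Rinv_0_lt_compat; lra. }
    assert (f y = - ln (1 - y) - log_trunc J y) by reflexivity.
    nra.
Qed.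

Lemma sum_n_Rplus (u v : nat -> R) (n : nat) :
  sum_n (fun i => u i + v i) n = sum_n u n + sum_n v n.
Proof. exact (sum_n_plus u v n). Qed.

Lemma exp_le (x y : R) : x <= y -> exp x <= exp y.
Proof.
  intros [H| ->]; [left; apply exp_increasing, H|right; reflexivity].
Qed.

(** The finite q-Pochhammer symbol (q; q)_m. *)
Fixpoint qpoch (q : R) (m : nat) : R :=
  match m with
  | O => 1
  | S m' => qpoch q m' * (1 - q ^ S m')
  end.

Lemma pow_S_range (q : R) (m : nat) : 0 < q < 1 -> 0 < q ^ S m <= q.
Proof.
  intros Hq; split; [apply pow_lt; lra|].
  assert (q ^ m <= 1) by (rewrite <- (pow1 m); apply pow_incr; lra).
  change (q ^ S m) with (q * q ^ m); nra.
Qed.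

Lemma qpoch_pos (q : R) (m : nat) : 0 < q < 1 -> 0 < qpoch q m.
Proof.
  intros Hq; induction m as [|m IH]; cbn [qpoch]; [lra|].
  assert (H := pow_S_range q m Hq).
  apply Rmult_lt_0_compat; lra.
Qed.

(** Adding the logarithm bounds at q^k for k = 1, ..., m gives, for each j = [S i], the finite
    geometric sum of (q^j)^k over k. Induction on [m] avoids an explicit exchange of sums. Each of
    the m remainders is largest at k = 1. *)
Lemma neg_ln_qpoch_le (q : R) (m J : nat) : 0 < q < 1 ->
  - ln (qpoch q m) <=
  sum_n (fun i => q ^ S i * (1 - (q ^ S i) ^ m) / (1 - q ^ S i) / INR (S i)) J
  + INR m * (q ^ S J / (1 - q)).
Proof.
  intros Hq; induction m as [|m IH].
  - rewrite (sum_n_ext _ (fun _ => 0)).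
    + rewrite sum_n_const; simpl; rewrite ln_1; lra.
    + intros i; simpl; unfold Rdiv; ring.
  - assert (Hm := pow_S_range q m Hq).
    cbn [qpoch]; rewrite ln_mult by (try apply qpoch_pos; lra).
    assert (H1 := neg_ln_le_log_trunc J (q ^ S m) ltac:(lra)).
    assert (H2 : (q ^ S m) ^ S J / (1 - q ^ S m) <= q ^ S J / (1 - q)).
    { apply Rmult_le_compat.
      - apply pow_le; lra.
      - left; apply Rinv_0_lt_compat; lra.
      - apply pow_incr; lra.
      - apply Rinv_le_contravar; lra. }
    rewrite (sum_n_ext _ (fun i =>
      q ^ S i * (1 - (q ^ S i) ^ m) / (1 - q ^ S i) / INR (S i)
      + (q ^ S m) ^ S i / INR (S i))).
    + rewrite sum_n_Rplus, S_INR; fold (log_trunc J (q ^ S m)); lra.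
    + intros i; assert (Hi := pow_S_range q i Hq).
      assert (INR (S i) <> 0) by (apply not_0_INR; lia).
      rewrite <- (pow_mult q (S m) (S i)), Nat.mul_comm, pow_mult.
      change ((q ^ S i) ^ S m) with (q ^ S i * (q ^ S i) ^ m).
      refine (_ : @eq R _ _); field; lra.
Qed.

(** With j = [S i], the left side is 1 / (exp (j gamma) - 1), and exp u > 1 + u for u > 0. *)
Lemma geom_tail_le (gamma : R) (i : nat) : 0 < gamma ->
  exp (- gamma) ^ S i / (1 - exp (- gamma) ^ S i) <= / (INR (S i) * gamma).
Proof.
  intros Hg.
  assert (Hi : 0 < INR (S i)) by (apply lt_0_INR; lia).
  replace (exp (- gamma) ^ S i) with (/ exp (INR (S i) * gamma)).
  - assert (H := exp_ineq1 (INR (S i) * gamma) ltac:(nra)).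
    assert (0 < INR (S i) * gamma) by nra.
    replace (/ exp (INR (S i) * gamma) / (1 - / exp (INR (S i) * gamma)))
      with (/ (exp (INR (S i) * gamma) - 1)) by (field; lra).
    apply Rinv_le_contravar; lra.
  - rewrite <- Rpower_pow by apply exp_pos.
    unfold Rpower; rewrite ln_exp, <- exp_Ropp; f_equal; ring.
Qed.

(* The constant is [sum_j 1 / (gamma * j ^ 2)]: expand
   [- sum_k ln (1 - q ^ k) = sum_j q ^ j / (j * (1 - q ^ j))] and use
   [1 / q ^ j - 1 >= j * gamma]. *)
Lemma qpoch_ge (gamma : R) (m : nat) : 0 < gamma ->
  exp (- (PI ^ 2 / (6 * gamma))) <= qpoch (exp (- gamma)) m.
Proof.
  intros Hg.
  assert (Hq : 0 < exp (- gamma) < 1).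
  { split; [apply exp_pos|]; rewrite <- exp_0; apply exp_increasing; lra. }
  set (q := exp (- gamma)) in *.
  assert (Hp := qpoch_pos q m Hq).
  rewrite <- (exp_ln (qpoch q m)) by exact Hp.
  apply exp_le.
  enough (- ln (qpoch q m) <= PI ^ 2 / (6 * gamma)) by lra.
  (* For fixed [m] the truncation error of the logarithms tends to 0 as [J] grows, so the bound
     survives in the limit without it. *)
  assert (HJ : forall J, - ln (qpoch q m) <=
    PI ^ 2 / (6 * gamma) + INR m / (1 - q) * q ^ S J).
  { intros J; eapply Rle_trans; [apply (neg_ln_qpoch_le q m J Hq)|].
    apply Rplus_le_compat; [|right; field; lra].
    apply Rle_trans with (sum_n (fun i => / gamma * / INR (S i) ^ 2) J).
    - apply sum_n_m_le; intros i.
      assert (Hi := pow_S_range q i Hq).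
      assert (HSi : 0 < INR (S i)) by (apply lt_0_INR; lia).
      replace (/ gamma * / INR (S i) ^ 2)
        with (/ (INR (S i) * gamma) * / INR (S i)) by (field; lra).
      apply Rmult_le_compat_r; [left; apply Rinv_0_lt_compat, HSi|].
      eapply Rle_trans; [|apply (geom_tail_le gamma i Hg)].
      apply Rmult_le_compat_r; [left; apply Rinv_0_lt_compat; fold q; lra|].
      fold q; assert (0 < (q ^ S i) ^ m) by (apply pow_lt; lra).
      nra.
    - replace (sum_n _ J) with (/ gamma * sum_n_m (fun k => / INR k ^ 2) 1 (S J)).
      2:{ rewrite <- sum_n_m_S; symmetry.
          exact (sum_n_m_mult_l (K := R_Ring) (/ gamma) _ 0 J). }
      assert (HB := sum_inv_sq_le (S J)).
      replace (PI ^ 2 / (6 * gamma)) with (/ gamma * (PI ^ 2 / 6)) by (field; lra).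
      apply Rmult_le_compat_l; [left; apply Rinv_0_lt_compat, Hg|exact HB]. }
  refine (is_lim_seq_le (fun _ => - ln (qpoch q m)) _
    (- ln (qpoch q m)) (PI ^ 2 / (6 * gamma)) HJ _ _).
  - apply is_lim_seq_const.
  - rewrite <- (Rplus_0_r (PI ^ 2 / (6 * gamma))) at 1.
    apply is_lim_seq_plus'; [apply is_lim_seq_const|].
    rewrite <- (Rmult_0_r (INR m / (1 - q))).
    apply (is_lim_seq_scal_l (fun J => q ^ S J) _ 0).
    apply (is_lim_seq_incr_1 (fun J => q ^ J) 0), is_lim_seq_geom.
    rewrite Rabs_pos_eq; lra.
Qed.

(** * Comparing the terms with differences of s^(n^2) *)

(** This is [triangular_exponent_le] divided by s^(n^2), with y = s^n; the condition [y <= s]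
    reflects n >= 1. The factor 1 - y^2 s^2 is at most 4/3 of the right side, and the rest of the
    product is at most 3/4. *)
Lemma telescoping_poly_bound (s y : R) : 0 < s < 1 -> 0 < y <= s ->
  y * (1 - y ^ 2 * s ^ 2) * (1 - y ^ 2 * s ^ 4) <= 1 - y ^ 2 * s.
Proof.
  intros Hs Hy.
  assert (Hy2 : 0 < y ^ 2 <= s ^ 2) by (split; [apply pow_lt|apply pow_incr]; lra).
  assert (Hy4 : y ^ 4 <= s ^ 4) by (apply pow_incr; lra).
  assert (Hs2 : 0 < s ^ 2 < 1) by nra.
  assert (H0 : 0 < 1 - y ^ 2 * s) by nra.
  assert (H1 : 1 - y ^ 2 * s ^ 2 <= 4 / 3 * (1 - y ^ 2 * s)).
  (* Since 1 - s^2 (3 - 2 s) = (1 - s)^2 (1 + 2 s), it follows that y^2 (3 - 2 s) <= 1, which is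
     [Hr] rearranged. Multiplying [Hr] by s < 1 gives the claim. *)
  { assert (y ^ 2 * (3 - 2 * s) <= s ^ 2 * (3 - 2 * s))
      by (apply Rmult_le_compat_r; lra).
    assert (0 <= (1 - s) ^ 2 * (1 + 2 * s))
      by (apply Rmult_le_pos; [apply pow2_ge_0|lra]).
    assert (Hr : 3 * y ^ 2 * (1 - s) <= 1 - y ^ 2 * s) by lra.
    apply (Rmult_le_compat_l s) in Hr; [nra|lra]. }
  assert (H2 : y * (1 - y ^ 2 * s ^ 4) <= 3 / 4).
  (* Lowering s to y leaves a polynomial in y alone. *)
  { assert (y ^ 2 * y ^ 4 <= y ^ 2 * s ^ 4) by (apply Rmult_le_compat_l; lra).
    assert (Hr : y * (1 - y ^ 2 * s ^ 4) <= y * (1 - y ^ 2 * y ^ 4))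
      by (apply Rmult_le_compat_l; lra).
    apply (Rle_trans _ _ _ Hr).
    (* [y - y ^ 7 <= 3 / 4], from a sum-of-squares certificate *)
    assert (0 <= y * (y ^ 3 - 2 / 5) ^ 2)
      by (apply Rmult_le_pos; [lra|apply pow2_ge_0]).
    assert (0 <= (y ^ 2 - 1 / 2) ^ 2) by apply pow2_ge_0.
    nra. }
  assert (H3 : 0 <= y * (1 - y ^ 2 * s ^ 4)).
  { apply Rmult_le_pos; [lra|].
    assert (0 < s ^ 4 < 1) by (replace (s ^ 4) with (s ^ 2 * s ^ 2) by ring; nra).
    nra. }
  replace (y * (1 - y ^ 2 * s ^ 2) * (1 - y ^ 2 * s ^ 4))
    with ((1 - y ^ 2 * s ^ 2) * (y * (1 - y ^ 2 * s ^ 4))) by ring.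
  apply Rle_trans with ((4 / 3 * (1 - y ^ 2 * s)) * (y * (1 - y ^ 2 * s ^ 4))).
  - apply Rmult_le_compat_r; assumption.
  - nra.
Qed.

Lemma triangular_exponent_le (s : R) (n : nat) : 0 < s < 1 -> (1 <= n)%nat ->
  (s ^ 2) ^ (n * (n + 1) / 2) * ((1 - (s ^ 2) ^ S n) * (1 - (s ^ 2) ^ S (S n)))
  <= s ^ (n * n) - s ^ (S n * S n).
Proof.
  intros Hs Hn.
  assert (Hy : 0 < s ^ n <= s).
  { destruct n as [|n]; [lia|apply pow_S_range, Hs]. }
  (* The division in [nat] is exact; this is checked by the parity of [n]. *)
  assert (Ht : (2 * (n * (n + 1) / 2) = n * n + n)%nat).
  { destruct (Nat.Even_or_Odd n) as [[k ->]|[k ->]].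
    - replace (2 * k * (2 * k + 1))%nat with ((k * (2 * k + 1)) * 2)%nat by lia.
      rewrite Nat.div_mul by lia; lia.
    - replace ((2 * k + 1) * (2 * k + 1 + 1))%nat
        with (((2 * k + 1) * (k + 1)) * 2)%nat by lia.
      rewrite Nat.div_mul by lia; lia. }
  rewrite <- !pow_mult, Ht.
  replace (2 * S n)%nat with (n * 2 + 2)%nat by lia.
  replace (2 * S (S n))%nat with (n * 2 + 4)%nat by lia.
  replace (S n * S n)%nat with (n * n + (n * 2 + 1))%nat by lia.
  rewrite !pow_add, !pow_mult, pow_1.
  rewrite <- (pow_mult s n n).
  assert (H := telescoping_poly_bound s (s ^ n) Hs Hy).
  assert (Hpos : 0 < s ^ (n * n)) by (apply pow_lt; lra).
  apply (Rmult_le_compat_l (s ^ (n * n))) in H; lra.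
Qed.

(** * Complex series and infinite products *)

(** Completeness gives convergence by comparison; the triangle inequality bounds the partial sums,
    and continuity of the modulus carries the bound to the limit. The explicit sum is what
    [CSeries_unique] needs. *)
Lemma is_series_Cmod_le (a : nat -> C) (b : nat -> R) (l : R) :
  (forall n, Cmod (a n) <= b n) -> is_series b l ->
  exists z : C, is_series a z /\ Cmod z <= l.
Proof.
  intros Hab Hb.
  destruct (ex_series_le (V := C_CompleteNormedModule) a b) as [z Hz].
  - exact Hab.
  - now exists l.
  - exists z; split; [exact Hz|].
    refine (is_lim_seq_le (fun n => Cmod (sum_n a n)) (sum_n b) (Cmod z) l _ _ Hb).
    + intros n; induction n as [|n IH].
      * rewrite !sum_O; apply Hab.
      * rewrite !sum_Sn; eapply Rle_trans; [apply Cmod_triangle|].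
        apply Rplus_le_compat; [exact IH|apply Hab].
    + exact (filterlim_comp _ _ _ (sum_n a) Cmod _ _ _ Hz
        (filterlim_norm (V := C_NormedModule) z)).
Qed.

Lemma is_series_telescope (D : nat -> R) : is_lim_seq D 0 ->
  is_series (fun n => D n - D (S n)) (D O).
Proof.
  intros HD.
  change (is_lim_seq (sum_n (fun n => D n - D (S n))) (D O)).
  apply (is_lim_seq_ext (fun n => D O - D (S n))).
  - intros n; induction n as [|n IH].
    + now rewrite sum_O.
    + rewrite sum_Sn, <- IH; unfold plus; simpl; ring.
  - replace (D O) with (D O - 0) at 1 by ring.
    apply is_lim_seq_minus'; [apply is_lim_seq_const|].
    now apply (is_lim_seq_incr_1 D).
Qed.

Lemma Cprod_n_m_S (f : nat -> C) (m : nat) :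
  Cprod_n_m f 1 (S m) = (Cprod_n_m f 1 m * f (S m))%C.
Proof.
  unfold Cprod_n_m.
  rewrite (Iter.iter_nat_Chasles Cmult (RtoC 1) Cmult_1_l Cmult_assoc f 1 m (S m))
    by lia.
  now rewrite (Iter.iter_nat_point Cmult (RtoC 1) Cmult_1_r).
Qed.

(** A general [f] covers both the denominators of [euler_coef] and the partial products of [Rtx]. *)
Lemma Cmod_Cprod_ge (f : nat -> C) (q : R) (m : nat) : 0 < q < 1 ->
  (forall k, Cmod (1 - f k) <= q ^ k) -> qpoch q m <= Cmod (Cprod_n_m f 1 m).
Proof.
  intros Hq Hf; induction m as [|m IH].
  - change (1 <= Cmod 1); rewrite Cmod_1; lra.
  - rewrite Cprod_n_m_S, Cmod_mult; cbn [qpoch].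
    assert (Hm := pow_S_range q m Hq).
    assert (Hp := qpoch_pos q m Hq).
    apply Rmult_le_compat; try lra.
    assert (H := Cmod_triangle (1 - f (S m)) (f (S m))).
    replace (1 - f (S m) + f (S m))%C with (RtoC 1) in H by ring.
    rewrite Cmod_1 in H.
    specialize (Hf (S m)); lra.
Qed.

(** Each factor has modulus at most 1 + q^k <= 1 / (1 - q^k), so a lower bound on [qpoch] also keeps
    the products bounded above. *)
Lemma Cmod_Cprod_le (f : nat -> C) (q : R) (m : nat) : 0 < q < 1 ->
  (forall k, Cmod (1 - f k) <= q ^ k) -> Cmod (Cprod_n_m f 1 m) <= / qpoch q m.
Proof.
  intros Hq Hf; induction m as [|m IH].
  - change (Cmod 1 <= / 1); rewrite Cmod_1; lra.
  - rewrite Cprod_n_m_S, Cmod_mult; cbn [qpoch].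
    assert (Hm := pow_S_range q m Hq).
    assert (Hp := qpoch_pos q m Hq).
    rewrite Rinv_mult.
    apply Rmult_le_compat; try apply Cmod_ge_0; [exact IH|].
    assert (H := Cmod_triangle 1 (- (1 - f (S m)))).
    replace (1 + - (1 - f (S m)))%C with (f (S m)) in H by ring.
    rewrite Cmod_1, Cmod_opp in H.
    specialize (Hf (S m)).
    apply Rle_trans with (1 + q ^ S m); [lra|].
    apply (Rmult_le_reg_r (1 - q ^ S m)); [lra|].
    rewrite Rinv_l by lra; nra.
Qed.

(** [CLim_seq] is informative only once convergence is known. The increments of the partial products
    are at most q^(n+1) / c in modulus, hence summable, and the lower bound on the partial products
    passes to the limit. *)
Lemma Cprod_lim_ge (f : nat -> C) (q c : R) : 0 < q < 1 -> 0 < c ->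
  (forall m, c <= qpoch q m) -> (forall k, Cmod (1 - f k) <= q ^ k) ->
  c <= Cmod (CLim_seq (Cprod_n_m f 1)).
Proof.
  intros Hq Hc Hcq Hf.
  set (P := Cprod_n_m f 1).
  destruct (is_series_Cmod_le (fun n => P (S n) - P n)%C
    (fun n => / c * q * q ^ n) (/ c * q * / (1 - q))) as [z [Hz _]].
  - intros n; unfold P; rewrite Cprod_n_m_S.
    replace (Cprod_n_m f 1 n * f (S n) - Cprod_n_m f 1 n)%C
      with (- (Cprod_n_m f 1 n * (1 - f (S n))))%C by ring.
    rewrite Cmod_opp, Cmod_mult, (Rmult_assoc (/ c)).
    apply Rmult_le_compat; try apply Cmod_ge_0; [|apply Hf].
    eapply Rle_trans; [apply Cmod_Cprod_le; eassumption|].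
    apply Rinv_le_contravar; auto.
  - apply (is_series_scal (K := R_AbsRing) (V := R_NormedModule) (/ c * q)
      (fun n => q ^ n) (/ (1 - q))).
    apply is_series_geom; rewrite Rabs_pos_eq; lra.
  - assert (HP : filterlim P eventually (locally (1 + z)%C)).
    { assert (Htel : forall k,
        P (S k) = plus (RtoC 1) (sum_n (fun n => (P (S n) - P n)%C) k)).
      { intros k; change plus with Cplus; induction k as [|k IH].
        - rewrite sum_O; change (P O) with (RtoC 1); ring.
        - rewrite sum_Sn; change plus with Cplus.
          rewrite Cplus_assoc, <- IH; ring. }
      intros U HU.
      destruct (filterlim_comp_2 _ _ _ (filterlim_const (RtoC 1)) Hz
        (filterlim_plus (V := C_NormedModule) (RtoC 1) z) U HU) as [m Hm].
      (* The sum of increments up to n yields the product up to n + 1, hence the shift. *)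
      exists (S m); intros [|n] Hn; [lia|].
      rewrite Htel; apply Hm; lia. }
    rewrite (CLim_seq_unique P _ HP).
    refine (is_lim_seq_le (fun _ => c) (fun n => Cmod (P n)) c (Cmod (1 + z)) _ _ _).
    + intros n; eapply Rle_trans; [apply Hcq|now apply Cmod_Cprod_ge].
    + apply is_lim_seq_const.
    + exact (filterlim_comp _ _ _ P Cmod _ _ _ HP
        (filterlim_norm (V := C_NormedModule) (1 + z)%C)).
Qed.

(** * Bounds on the coefficients and the truncation errors *)

(** Bounding |x| by a square [s ^ 2] keeps all exponents integral. The bound [c] is used at index n
    + 2, not n: the two extra factors [u] go to the numerator and make the difference of powers
    possible. *)
Lemma Cmod_euler_coef_le (s c : R) (t x : C) (n : nat) : 0 < s < 1 -> 0 < c ->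
  (forall m, c <= qpoch (s ^ 2) m) -> Cmod t <= 1 -> Cmod x <= s ^ 2 ->
  (1 <= n)%nat ->
  Cmod (euler_coef t x n) <= / c * (s ^ (n * n) - s ^ (S n * S n)).
Proof.
  intros Hs Hc Hcq Ht Hx Hn.
  assert (Hq : 0 < s ^ 2 < 1) by (split; nra).
  assert (Hpow : forall k, Cmod (x ^ k) <= (s ^ 2) ^ k).
  { intros k; rewrite Cmod_pow; apply pow_incr; split; [apply Cmod_ge_0|exact Hx]. }
  assert (Hden : qpoch (s ^ 2) n <= Cmod (Cprod_n_m (fun k => (1 - x ^ k)%C) 1 n)).
  { apply Cmod_Cprod_ge; [exact Hq|]; intros k.
    replace (1 - (1 - x ^ k))%C with (x ^ k)%C by ring; apply Hpow. }
  assert (Hp := qpoch_pos (s ^ 2) n Hq).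
  assert (H1 := pow_S_range (s ^ 2) n Hq).
  assert (H2 := pow_S_range (s ^ 2) (S n) Hq).
  unfold euler_coef; rewrite Cmod_div by (apply Cmod_gt_0; lra).
  rewrite Cmod_mult, (Cmod_pow (- t)), Cmod_opp.
  apply Rle_trans with ((s ^ 2) ^ (n * (n + 1) / 2) / qpoch (s ^ 2) n).
  - apply Rmult_le_compat.
    + apply Rmult_le_pos; [apply pow_le|]; apply Cmod_ge_0.
    + left; apply Rinv_0_lt_compat; lra.
    + rewrite <- (Rmult_1_l ((s ^ 2) ^ _)).
      apply Rmult_le_compat; try apply Cmod_ge_0; [apply pow_le, Cmod_ge_0| |apply Hpow].
      rewrite <- (pow1 n); apply pow_incr; split; [apply Cmod_ge_0|exact Ht].
    + apply Rinv_le_contravar; lra.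
  - set (u := (1 - (s ^ 2) ^ S n) * (1 - (s ^ 2) ^ S (S n))).
    assert (Hu : 0 < u) by (apply Rmult_lt_0_compat; lra).
    replace ((s ^ 2) ^ (n * (n + 1) / 2) / qpoch (s ^ 2) n)
      with (/ qpoch (s ^ 2) (S (S n)) * ((s ^ 2) ^ (n * (n + 1) / 2) * u))
      by (cbn [qpoch]; unfold u; field; lra).
    apply Rmult_le_compat.
    + left; apply Rinv_0_lt_compat, qpoch_pos, Hq.
    + apply Rmult_le_pos; [apply pow_le|]; lra.
    + apply Rinv_le_contravar; auto.
    + apply triangular_exponent_le; assumption.
Qed.

Lemma abs_trunc_error_le (s c : R) (t x : C) (N : nat) : 0 < s < 1 -> 0 < c ->
  (forall m, c <= qpoch (s ^ 2) m) -> Cmod t <= 1 -> Cmod x <= s ^ 2 ->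
  (1 <= N)%nat -> abs_trunc_error t x N <= / c * s ^ (N * N).
Proof.
  intros Hs Hc Hcq Ht Hx HN.
  set (D := fun k => s ^ ((N + k) * (N + k))).
  assert (HD : is_lim_seq D 0).
  (* [D] is squeezed between 0 and s^k because k <= (N + k)^2. *)
  { apply (is_lim_seq_le_le (fun _ => 0) D (fun k => s ^ k)).
    - intros k; unfold D; split; [apply pow_le; lra|].
      replace ((N + k) * (N + k))%nat with (k + ((N + k) * (N + k) - k))%nat by nia.
      rewrite pow_add; rewrite <- (Rmult_1_r (s ^ k)) at 2.
      apply Rmult_le_compat_l; [apply pow_le; lra|].
      rewrite <- (pow1 ((N + k) * (N + k) - k)); apply pow_incr; lra.
    - apply is_lim_seq_const.
    - apply is_lim_seq_geom; rewrite Rabs_pos_eq; lra. }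
  destruct (is_series_Cmod_le (fun k => euler_coef t x (N + k))
    (fun k => / c * (D k - D (S k))) (/ c * D O)) as [z [Hz Hle]].
  - intros k; unfold D; rewrite Nat.add_succ_r.
    apply Cmod_euler_coef_le; auto; lia.
  - apply (is_series_scal (K := R_AbsRing) (V := R_NormedModule) (/ c)
      (fun k => D k - D (S k)) (D O)).
    apply is_series_telescope, HD.
  - unfold abs_trunc_error; rewrite (CSeries_unique _ _ Hz).
    unfold D in Hle; rewrite Nat.add_0_r in Hle; exact Hle.
Qed.

Theorem corollary3p4 (K gamma : R) (t x : C) (N : nat)
  (hK : 0 <= K) (hgamma : 0 < gamma)
  (ht : Cmod t <= 1) (hx : Cmod x <= exp (- gamma)) :
  (INR N >= sqrt (PI ^ 2 / (3 * gamma ^ 2) + 2 * K / gamma) ->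
     abs_trunc_error t x N <= exp (- K))
  /\
  (INR N >= sqrt (2 * PI ^ 2 / (3 * gamma ^ 2) + 2 * K / gamma) ->
     rel_trunc_error t x N <= exp (- K)).
Proof.
  set (s := exp (- gamma / 2)).
  set (b := PI ^ 2 / (6 * gamma)).
  assert (Hs : 0 < s < 1).
  { split; [apply exp_pos|]; rewrite <- exp_0; apply exp_increasing; lra. }
  assert (Hq : exp (- gamma) = s ^ 2).
  { unfold s; simpl; rewrite Rmult_1_r, <- exp_plus; f_equal; field. }
  assert (Hcq : forall m, exp (- b) <= qpoch (s ^ 2) m).
  { intros m; rewrite <- Hq; apply qpoch_ge, hgamma. }
  assert (Hc := exp_pos (- b)).
  rewrite Hq in hx.
  assert (Hb : 0 < b).
  { apply Rdiv_lt_0_compat; [|lra]. apply pow_lt, PI_RGT_0. }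
  (* Here j = 1 serves the absolute error and j = 2 the relative one: one b absorbs the factor exp b
     in the tail bound, a second one absorbs the division by |R(t,x)|. *)
  assert (HN : forall j, 1 <= j ->
    INR N >= sqrt (2 / gamma * (j * b + K)) ->
    abs_trunc_error t x N <= exp (b - (j * b + K))).
  { intros j Hj HN.
    set (A := 2 / gamma * (j * b + K)) in *.
    assert (HA : 0 < A).
    { apply Rmult_lt_0_compat; [apply Rdiv_lt_0_compat; lra|nra]. }
    assert (HA2 := sqrt_sqrt A (Rlt_le _ _ HA)).
    assert (HA3 := sqrt_lt_R0 A HA).
    (* Since b > 0, the threshold is positive even when K = 0, which rules out N = 0. *)
    assert (HN1 : (1 <= N)%nat) by (apply INR_lt; simpl; lra).
    eapply Rle_trans;
      [apply (abs_trunc_error_le s (exp (- b))); assumption|].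
    rewrite <- exp_Ropp, Ropp_involutive.
    replace (s ^ (N * N)) with (exp (- gamma / 2 * (INR N * INR N))).
    - rewrite <- exp_plus; apply exp_le.
      assert (A <= INR N * INR N) by nra.
      assert (gamma / 2 * A = j * b + K) by (unfold A; field; lra).
      nra.
    - rewrite <- (Rpower_pow _ s) by apply Hs.
      unfold Rpower, s; rewrite ln_exp, mult_INR; f_equal; ring. }
  split; intros H.
  - replace (exp (- K)) with (exp (b - (1 * b + K))) by (f_equal; ring).
    apply HN; [lra|].
    replace (2 / gamma * (1 * b + K))
      with (PI ^ 2 / (3 * gamma ^ 2) + 2 * K / gamma) by (unfold b; field; lra).
    exact H.
  - assert (HR : exp (- b) <= Cmod (Rtx t x)).
    { apply (Cprod_lim_ge _ (s ^ 2)); [split; nra|exact Hc|exact Hcq|].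
      intros k; replace (1 - (1 - t * x ^ k))%C with (t * x ^ k)%C by ring.
      rewrite Cmod_mult, Cmod_pow.
      rewrite <- (Rmult_1_l ((s ^ 2) ^ k)).
      apply Rmult_le_compat; [apply Cmod_ge_0|apply pow_le, Cmod_ge_0|exact ht|].
      apply pow_incr; split; [apply Cmod_ge_0|exact hx]. }
    assert (HE : abs_trunc_error t x N <= exp (b - (2 * b + K))).
    { apply HN; [lra|].
      replace (2 / gamma * (2 * b + K))
        with (2 * PI ^ 2 / (3 * gamma ^ 2) + 2 * K / gamma) by (unfold b; field; lra).
      exact H. }
    unfold rel_trunc_error.
    (* [HR] makes the denominator positive, so the quotient is a genuine one. *)
    apply (Rmult_le_reg_r (Cmod (Rtx t x))); [lra|].
    unfold Rdiv; rewrite Rmult_assoc, Rinv_l, Rmult_1_r by lra.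
    eapply Rle_trans; [exact HE|].
    replace (b - (2 * b + K)) with (- K + - b) by ring.
    rewrite exp_plus.
    apply Rmult_le_compat_l; [left; apply exp_pos|exact HR].
Qed.
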